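(* Let $d,n,M\in\mathbb{N}$, $t_1,\dots,t_M\in[0,1)^d$, $z_j:=\mathrm{e}^{2\pi\mathrm{i}t_j}$, $q>0$, and let $\Omega:=\{z_j:j=1,\dots,M\}$ be $q$-separated. Let $\hat f_1,\dots,\hat f_M>0$ be real and let $T=T_n(f)$ be the multilevel Toeplitz matrix of $f(k)=\sum_{j=1}^M\hat f_jz_j^k$, $k\in\mathbb{Z}^d$. If $n>2dq^{-1}$, then there exist weights $w_k>0$, $k\in I_n$, such that with the diagonal matrix $W=\operatorname{diag}(w_k)_{k\in I_n}$ one has $$\operatorname{cond}_2(WTW)\le\frac{(nq)^{d+1}+(2d)^{d+1}}{(nq)^{d+1}-(2d)^{d+1}}\cdot\frac{\max_j\hat f_j}{\min_j\hat f_j}.$$ In particular, with such a choice of $W=W_n$ for each $n>2dq^{-1}$ (and $d$, $M$, $q$, $t_j$, $\hat f_j$ fixed), $$\lim_{n\to\infty}\operatorname{cond}_2(W_nT_n(f)W_n)=\frac{\max_j\hat f_j}{\min_j\hat f_j}.$$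
   Context: For $t\in\mathbb{R}^d$ write $\mathrm{e}^{2\pi\mathrm{i}t}:=(\mathrm{e}^{2\pi\mathrm{i}t_1},\dots,\mathrm{e}^{2\pi\mathrm{i}t_d})$. For $z\in(\mathbb{C}\setminus\{0\})^d$ and $k\in\mathbb{Z}^d$ write $z^k:=z_1^{k_1}\cdots z_d^{k_d}$. The separation distance of $\Omega=\{\mathrm{e}^{2\pi\mathrm{i}t_j}:j=1,\dots,M\}$ is $\operatorname{sep}(\Omega):=\min_{r\in\mathbb{Z}^d,\ j\ne\ell}\|t_j-t_\ell+r\|_\infty$ (the minimum over all $r\in\mathbb{Z}^d$ and all indices $j\neq\ell$ in $\{1,\dots,M\}$; it is $+\infty$ if $M=1$). $\Omega$ is called $q$-separated if $\operatorname{sep}(\Omega)>q$; in particular the $t_j$ are then pairwise distinct. Let $I_n:=\{0,\dots,n\}^d$ and $N:=|I_n|=(n+1)^d$. For $f\colon\mathbb{Z}^d\to\mathbb{C}$, the matrix $T_n(f)\in\mathbb{C}^{N\times N}$ has entry $f(k-\ell)$ in row $\ell\in I_n$ and column $k\in I_n$. For a (possibly singular) nonzero matrix $B$, $\operatorname{cond}_2B:=\|B\|_2\,\|B^\dagger\|_2$, where $\|\cdot\|_2$ is the spectral norm and $B^\dagger$ is the Moore–Penrose pseudoinverse. *)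

(* Defs.v *)
From HB Require Import structures.
From mathcomp Require Import all_boot all_order all_algebra.
From mathcomp Require Import all_classical all_reals all_analysis.
From mathcomp Require Import complex.

Set Implicit Arguments.
Unset Strict Implicit.
Unset Printing Implicit Defensive.

Import Order.TTheory GRing.Theory Num.Theory.
Import numFieldNormedType.Exports.

Local Open Scope classical_set_scope.
Local Open Scope complex_scope.
Local Open Scope sesquilinear_scope.
Local Open Scope ring_scope.

(* ComplexField.Normc.normc is the real-valued modulus; `|x| on R[i] is
   R[i]-valued. *)
Definition l2norm (R : realType) (n : nat) (x : 'cV[R[i]]_n) : R :=
  Num.sqrt (\sum_(i < n) ComplexField.Normc.normc (x i 0) ^+ 2).

Definition specnorm (R : realType) (m n : nat) (A : 'M[R[i]]_(m, n)) : R :=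
  sup [set l2norm (A *m x) | x in [set x | l2norm x <= 1]].

Definition is_pinv (R : realType) (m n : nat)
    (A : 'M[R[i]]_(m, n)) (X : 'M[R[i]]_(n, m)) : Prop :=
  [/\ A *m X *m A = A, X *m A *m X = X,
      (A *m X)^t* = A *m X & (X *m A)^t* = X *m A].

(* Total by choice; the default 0 is never reached, see [pinvP]. *)
Definition pinv (R : realType) (m n : nat) (A : 'M[R[i]]_(m, n)) :
    'M[R[i]]_(n, m) :=
  xget 0 [set X | is_pinv A X].

Definition cond2 (R : realType) (n : nat) (A : 'M[R[i]]_n) : R :=
  specnorm A * specnorm (pinv A).

Section PinvTheory.
Variable R : realType.
Implicit Types m n r : nat.

Lemma trmxCM m n r (A : 'M[R[i]]_(m, n)) (B : 'M[R[i]]_(n, r)) :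
  (A *m B)^t* = B^t* *m A^t*.
Proof. by rewrite trmx_mul map_mxM. Qed.

Lemma trmxC_K m n (A : 'M[R[i]]_(m, n)) : A^t*^t* = A.
Proof. by apply/matrixP => i j; rewrite !mxE conjCK. Qed.

Lemma gram_unitmx r n (A : 'M[R[i]]_(r, n)) :
  row_free A -> A *m A^t* \in unitmx.
Proof.
move=> fA; rewrite -row_free_unit -kermx_eq0; apply/eqP/row_matrixP => i.
rewrite row0; set v := row i _.
have : v *m (A *m A^t*) = 0.
  by apply/sub_kermxP; exact: row_sub.
move=> /(congr1 (fun M => M *m v^t*)); rewrite mul0mx.
rewrite mulmxA -(mulmxA (v *m A)) -trmxCM => /matrixP/(_ 0 0).
rewrite !mxE => /eqP; rewrite psumr_eq0; last first.
  by move=> j _; rewrite !mxE -normCK exprn_ge0.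
move=> /allP h; apply: (row_free_inj fA); rewrite mul0mx.
apply/rowP => j; rewrite [RHS]mxE.
have := h j (mem_index_enum _); rewrite [_^t* _ _]mxE [_^T _ _]mxE -normCK /=.
by rewrite sqrf_eq0 normr_eq0 => /eqP.
Qed.

Lemma pinv_exists m n (A : 'M[R[i]]_(m, n)) : exists X, is_pinv A X.
Proof.
have [r [C [B [AE fC fB]]]] : exists r (C : 'M[R[i]]_(m, r))
    (B : 'M[R[i]]_(r, n)), [/\ A = C *m B, row_free (C^t*) & row_free B].
  exists (\rank A), (col_base A), (row_base A); split.
  - by rewrite mulmx_base.
  - rewrite /row_free mxrank_map mxrank_tr -/(row_full _).
    exact: col_base_full.
  - exact: row_base_free.
have uB : B *m B^t* \in unitmx by exact: gram_unitmx.
have uC : C^t* *m C \in unitmx by rewrite -{2}(trmxC_K C); exact: gram_unitmx.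
pose G := invmx (B *m B^t*); pose H := invmx (C^t* *m C).
have BG : B *m B^t* *m G = 1%:M by rewrite mulmxV.
have HC : H *m (C^t* *m C) = 1%:M by rewrite mulVmx.
pose X := B^t* *m G *m H *m C^t*.
have AX : A *m X = C *m H *m C^t*.
  rewrite AE /X !mulmxA -[C *m B *m _]mulmxA -[C *m _ *m G]mulmxA BG.
  by rewrite mulmx1.
have XA : X *m A = B^t* *m G *m B.
  rewrite AE /X !mulmxA -[_ *m H *m C^t* *m C]mulmxA -[_ *m H *m _]mulmxA HC.
  by rewrite mulmx1.
have hV k (K : 'M[R[i]]_k) : K^t* = K -> (invmx K)^t* = invmx K.
  by move=> hK; rewrite trmx_inv map_invmx hK.
have hG : G^t* = G by apply: hV; rewrite trmxCM trmxC_K.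
have hH : H^t* = H by apply: hV; rewrite trmxCM trmxC_K.
exists X; split.
- by rewrite AX {1}AE mulmxA -[_ *m C^t* *m C]mulmxA -[_ *m H *m _]mulmxA HC
    mulmx1 -AE.
- rewrite XA /X !mulmxA -[_ *m B *m B^t*]mulmxA -[_ *m (B *m B^t*) *m G]mulmxA.
  by rewrite BG mulmx1.
- by rewrite AX !trmxCM trmxC_K hH mulmxA.
- by rewrite XA !trmxCM trmxC_K hG mulmxA.
Qed.

Lemma is_pinv_uniq m n (A : 'M[R[i]]_(m, n)) X Y :
  is_pinv A X -> is_pinv A Y -> X = Y.
Proof.
move=> [X1 X2 X3 X4] [Y1 Y2 Y3 Y4].
have AXY : A *m X = A *m Y.
  by rewrite -X3 -{1}Y1 -(mulmxA (A *m Y)) trmxCM X3 Y3 !mulmxA X1.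
have XYA : X *m A = Y *m A.
  rewrite -X4 -{1}Y1 -(mulmxA A) mulmxA trmxCM X4 Y4 -!mulmxA.
  by rewrite (mulmxA A X) X1.
by rewrite -X2 XYA -mulmxA AXY mulmxA Y2.
Qed.

Lemma pinvP m n (A : 'M[R[i]]_(m, n)) : is_pinv A (pinv A).
Proof.
exact: (@xgetPex _ 0 [set X | is_pinv A X] (pinv_exists A)).
Qed.

End PinvTheory.

Definition cis2pi (R : realType) (s : R) : R[i] :=
  cos (2 * pi * s) +i* sin (2 * pi * s).

Definition expi (R : realType) (d : nat) (t : 'rV[R]_d) : 'rV[R[i]]_d :=
  map_mx (@cis2pi R) t.

Definition zpow (R : realType) (d : nat) (z : 'rV[R[i]]_d) (k : 'rV[int]_d) :
    R[i] :=
  \prod_(i < d) z 0 i ^ k 0 i.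

(* The norm on 'rV[R]_d is the maximum norm.  Being an infimum in the extended
   reals, [sep t] is +oo when M = 1. *)
Definition sep (R : realType) (d M : nat) (t : 'I_M -> 'rV[R]_d) : \bar R :=
  ereal_inf [set (mx_norm (t p.1.1 - t p.1.2 + map_mx intr p.2))%:E
            | p in [set p : 'I_M * 'I_M * 'rV[int]_d | p.1.1 != p.1.2]].

Definition q_separated (R : realType) (d M : nat) (q : R)
    (t : 'I_M -> 'rV[R]_d) : Prop :=
  (q%:E < sep t)%E.

Notation box d n := 'rV['I_n.+1]_d.

(* Differences of multi-indices must be taken in int: subtraction in 'I_n.+1
   is modulo n + 1. *)
Definition boxZ (d n : nat) (k : box d n) : 'rV[int]_d :=
  map_mx (fun a : 'I_n.+1 => (nat_of_ord a)%:Z) k.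

(* Rows and columns are indexed by [box d n] through [enum_val]. *)
Definition toeplitz (R : realType) (d n : nat) (f : 'rV[int]_d -> R[i]) :
    'M[R[i]]_#|{: box d n}| :=
  \matrix_(l, k) f (boxZ (enum_val k) - boxZ (enum_val l)).

Definition expsum (R : realType) (d M : nat) (fhat : 'I_M -> R)
    (z : 'I_M -> 'rV[R[i]]_d) (k : 'rV[int]_d) : R[i] :=
  \sum_(j < M) (fhat j)%:C * zpow (z j) k.

Definition weight_mx (R : realType) (d n : nat) (w : box d n -> R) :
    'M[R[i]]_#|{: box d n}| :=
  diag_mx (\row_k (w (enum_val k))%:C).

Definition fmax (R : realType) (M : nat) (M_gt0 : (0 < M)%N) (a : 'I_M -> R) :
    R :=
  \big[Num.max/a (Ordinal M_gt0)]_(j < M) a j.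

Definition fmin (R : realType) (M : nat) (M_gt0 : (0 < M)%N) (a : 'I_M -> R) :
    R :=
  \big[Num.min/a (Ordinal M_gt0)]_(j < M) a j.

(* Main.v *)
Require Import Defs.
From HB Require Import structures.
From mathcomp Require Import all_boot all_order all_algebra.
From mathcomp Require Import all_classical all_reals all_analysis.
From mathcomp Require Import complex.
From mathcomp Require Import ring lra.

Set Implicit Arguments.
Unset Strict Implicit.
Unset Printing Implicit Defensive.

Import Order.TTheory GRing.Theory Num.Theory.
Import numFieldNormedType.Exports.

Local Open Scope classical_set_scope.
Local Open Scope ring_scope.

(* With A = (z_j^k)_{j,k}, B = A W and D = diag(fhat) one has W T W = B^* D B,
   so the nonzero spectrum of W T W is that of D^{1/2} G D^{1/2} with G = B B^*,
   G_{jl} = K(t_j - t_l) and K(x) = sum_k w_k^2 e^{2 pi i k.x}.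

   Upper bound: let the w_k^2 be the tensor products of the coefficients of a
   discrete B-spline of order d + 1.  Then K is a product of univariate kernels
   with |K_1(x)| <= K_1(0) min(1, ((d+1) / (2 n |x|))^{d+1}) for |x| <= 1/2.
   In the grid of cubes of side q with a vertex at t_j, separation puts at most
   one node into each cube and none into the 2^d cubes around t_j, so the
   off-diagonal row sums of G are at most K(0) ((2 + 2 c zeta(d+1))^d - 2^d) with
   c = ((d+1) / (2 n q))^{d+1}.  This is at most K(0) (2 d / (n q))^{d+1}, and
   Gershgorin's argument bounds the spectrum of G.

   Limit: for all positive weights G has constant diagonal s, so
   D^{1/2} G D^{1/2} has diagonal s fhat_j; as G is nonsingular once it is so for
   one choice of weights, cond_2(W T W) >= max fhat / min fhat. *)

(** * Euclidean and spectral norms *)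

Section Modulus.
Local Open Scope complex_scope.
Variable R : realType.
Local Notation normc := (@ComplexField.Normc.normc R).
Implicit Types z : R[i].

Lemma normc_ge0 z : 0 <= normc z.
Proof. by case: z => a b; rewrite sqrtr_ge0. Qed.

Lemma norm_normc z : `|z| = (normc z)%:C.
Proof. by rewrite normc_def; case: z. Qed.

Lemma normcR (a : R) : normc a%:C = `|a|.
Proof. by rewrite /= expr0n addr0 sqrtr_sqr. Qed.

Lemma normc_conj z : normc z^* = normc z.
Proof. by case: z => a b /=; rewrite sqrrN. Qed.

Lemma conj_real (a : R) : Num.conj a%:C = a%:C.
Proof. by apply/eqP; rewrite eq_complex /= oppr0 !eqxx. Qed.

Lemma normcX z n : normc (z ^+ n) = normc z ^+ n.
Proof.
elim: n => [|n IH]; first by rewrite !expr0 ComplexField.Normc.normc1.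
by rewrite !exprS ComplexField.Normc.normcM IH.
Qed.

Lemma normc_prod (I : finType) (F : I -> R[i]) :
  normc (\prod_i F i) = \prod_i normc (F i).
Proof.
apply: (big_morph normc (@ComplexField.Normc.normcM R)).
exact: ComplexField.Normc.normc1.
Qed.

Lemma ler_normc_sum (I : finType) (P : pred I) (F : I -> R[i]) :
  normc (\sum_(i | P i) F i) <= \sum_(i | P i) normc (F i).
Proof.
elim/big_ind2: _ => [|x1 x2 y1 y2 h1 h2|//].
  by rewrite ComplexField.Normc.normc0.
apply: le_trans (lerD h1 h2).
by rewrite -lecR rmorphD /= -!norm_normc ler_normD.
Qed.

Lemma sqr_normc_conj z : (normc z ^+ 2)%:C = z^* * z.
Proof. by rewrite mulrC -sqr_normc norm_normc rmorphXn. Qed.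

End Modulus.

Section EuclideanNorm.
Local Open Scope complex_scope.
Local Open Scope sesquilinear_scope.
Variable R : realType.
Local Notation normc := (@ComplexField.Normc.normc R).

(** Lagrange's identity: the difference of the two sides is half the double sum of (a_i b_j - a_j
    b_i)^2. *)
Lemma cauchy_schwarz_sum (n : nat) (a b : 'I_n -> R) :
  (\sum_i a i * b i) ^+ 2 <= (\sum_i a i ^+ 2) * (\sum_i b i ^+ 2).
Proof.
have : 0 <= \sum_i \sum_j (a i * b j - a j * b i) ^+ 2.
  by apply: sumr_ge0 => i _; apply: sumr_ge0 => j _; exact: sqr_ge0.
have -> : \sum_i \sum_j (a i * b j - a j * b i) ^+ 2 =
    \sum_i \sum_j (a i ^+ 2 * b j ^+ 2 + b i ^+ 2 * a j ^+ 2
                    - 2 * ((a i * b i) * (a j * b j))).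
  by apply: eq_bigr => i _; apply: eq_bigr => j _; ring.
under eq_bigr do rewrite big_split sumrN big_split -!mulr_sumr /=.
rewrite big_split sumrN big_split -!mulr_sumr -!mulr_suml /=.
rewrite expr2; lra.
Qed.

Lemma l2norm_ge0 (n : nat) (x : 'cV[R[i]]_n) : 0 <= l2norm x.
Proof. exact: sqrtr_ge0. Qed.

Lemma sqr_l2norm (n : nat) (x : 'cV[R[i]]_n) :
  l2norm x ^+ 2 = \sum_i normc (x i 0) ^+ 2.
Proof. by rewrite sqr_sqrtr// sumr_ge0// => i _; exact: sqr_ge0. Qed.

Lemma dotmx_self (n : nat) (x : 'cV[R[i]]_n) :
  (x^t* *m x) 0 0 = (l2norm x ^+ 2)%:C.
Proof.
rewrite sqr_l2norm rmorph_sum mxE; apply: eq_bigr => i _.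
by rewrite /= sqr_normc_conj !mxE.
Qed.

Lemma cauchy_schwarz (n : nat) (x y : 'cV[R[i]]_n) :
  normc ((x^t* *m y) 0 0) <= l2norm x * l2norm y.
Proof.
rewrite -(@ler_pXn2r _ 2)// ?nnegrE ?normc_ge0 ?mulr_ge0 ?l2norm_ge0//.
rewrite exprMn !sqr_l2norm; apply: le_trans _ (cauchy_schwarz_sum _ _).
rewrite ler_pXn2r// ?nnegrE ?normc_ge0 ?sumr_ge0//; last first.
  by move=> i _; rewrite mulr_ge0// normc_ge0.
rewrite mxE; apply: le_trans (ler_normc_sum _ _) _.
apply: ler_sum => i _.
by rewrite !mxE ComplexField.Normc.normcM [X in X * _ <= _]normc_conj.
Qed.

Lemma l2norm0 n : l2norm (0 : 'cV[R[i]]_n) = 0.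
Proof.
apply/eqP; rewrite -(@sqrf_eq0 R) sqr_l2norm big1// => i _.
by rewrite mxE ComplexField.Normc.normc0 expr0n.
Qed.

Lemma l2norm0_eq0 n (x : 'cV[R[i]]_n) : l2norm x = 0 -> x = 0.
Proof.
move=> /eqP; rewrite -(@sqrf_eq0 R) sqr_l2norm psumr_eq0; last first.
  by move=> i _; exact: sqr_ge0.
move=> /allP h; apply/colP => i; have := h i (mem_index_enum _).
by rewrite sqrf_eq0 => /eqP /ComplexField.Normc.eq0_normc ->; rewrite mxE.
Qed.

Lemma l2normZ n (a : R[i]) (x : 'cV[R[i]]_n) :
  l2norm (a *: x) = normc a * l2norm x.
Proof.
apply/eqP; rewrite -(@eqrXn2 _ 2)// ?mulr_ge0 ?l2norm_ge0 ?normc_ge0//.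
rewrite exprMn !sqr_l2norm mulr_sumr; apply/eqP/eq_bigr => i _.
by rewrite mxE ComplexField.Normc.normcM exprMn.
Qed.

(** [specnorm] is a supremum of reals, so its upper-bound property rests on this boundedness. *)
Lemma l2norm_mulmx_bounded m n (A : 'M[R[i]]_(m, n)) :
  exists C : R, forall x : 'cV_n, l2norm x <= 1 -> l2norm (A *m x) <= C.
Proof.
exists (Num.sqrt (\sum_i (\sum_j normc (A i j)) ^+ 2)) => x x1.
apply: ler_wsqrtr; apply: ler_sum => i _.
have h0 : 0 <= \sum_j normc (A i j) by apply: sumr_ge0 => j _; exact: normc_ge0.
rewrite ler_pXn2r// ?nnegrE ?normc_ge0// mxE.
apply: le_trans (ler_normc_sum _ _) _; apply: ler_sum => j _.
rewrite ComplexField.Normc.normcM ler_piMr ?normc_ge0//.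
apply: le_trans x1; rewrite -(@ler_pXn2r _ 2)// ?nnegrE ?normc_ge0 ?l2norm_ge0//.
by rewrite sqr_l2norm (bigD1 j)//= lerDl sumr_ge0// => k _; exact: sqr_ge0.
Qed.

Lemma specnorm_le m n (A : 'M[R[i]]_(m, n)) (C : R) : 0 <= C ->
  (forall x : 'cV_n, l2norm (A *m x) <= C * l2norm x) -> specnorm A <= C.
Proof.
move=> C0 h; apply: ge_sup.
  by exists (l2norm (A *m 0)); exists 0; rewrite //= l2norm0.
move=> _ [x /= x1 <-]; apply: le_trans (h x) _.
by rewrite -[leRHS]mulr1 ler_wpM2l.
Qed.

Lemma l2norm_mulmx_le m n (A : 'M[R[i]]_(m, n)) (x : 'cV_n) :
  l2norm (A *m x) <= specnorm A * l2norm x.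
Proof.
have [x0|x0] := eqVneq (l2norm x) 0.
  by rewrite (l2norm0_eq0 x0) mulmx0 !l2norm0 mulr0.
have xp : 0 < l2norm x by rewrite lt_neqAle eq_sym x0 l2norm_ge0.
have nV : normc ((l2norm x)^-1)%:C = (l2norm x)^-1.
  by rewrite normcR ger0_norm// invr_ge0 l2norm_ge0.
rewrite -ler_pdivrMr// mulrC -nV -l2normZ scalemxAr.
apply: ub_le_sup.
  have [C hC] := l2norm_mulmx_bounded A.
  by exists C => _ [y /= y1 <-]; exact: hC.
by exists (((l2norm x)^-1)%:C *: x) => //=; rewrite l2normZ nV mulVf.
Qed.

Lemma specnorm_ge0 m n (A : 'M[R[i]]_(m, n)) : 0 <= specnorm A.
Proof.
apply: ub_le_sup.
  have [C hC] := l2norm_mulmx_bounded A.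
  by exists C => _ [y /= y1 <-]; exact: hC.
by exists 0; rewrite /= ?mulmx0 l2norm0.
Qed.

Lemma le_of_sqr_le (u k : R) : 0 <= u -> 0 <= k -> u ^+ 2 <= k * u -> u <= k.
Proof.
rewrite le_eqVlt => /orP[/eqP<-//|u0] k0.
by rewrite expr2 ler_pM2r.
Qed.

Lemma diag_mx_real_herm n (a : 'I_n -> R) :
  (diag_mx (\row_j (a j)%:C))^t* = diag_mx (\row_j (a j)%:C).
Proof.
apply/matrixP => i j; rewrite !mxE [i == j]eq_sym.
by case: eqVneq => [->|_]; rewrite ?mulr0n ?mulr1n ?conjC0// conj_real.
Qed.

Lemma normc_quad_le_specnorm n (A : 'M[R[i]]_n) (x : 'cV_n) :
  normc ((x^t* *m (A *m x)) 0 0) <= specnorm A * l2norm x ^+ 2.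
Proof.
apply: le_trans (cauchy_schwarz _ _) _.
by rewrite expr2 mulrA mulrC ler_wpM2r ?l2norm_ge0// l2norm_mulmx_le.
Qed.

(** The product E of a matrix with its pseudoinverse is an orthogonal projection, so |E y|^2 = <y, E
    y> <= |y| |E y|. *)
Lemma l2norm_pinv_proj m n (A : 'M[R[i]]_(m, n)) (y : 'cV_m) :
  l2norm (A *m (Defs.pinv A *m y)) <= l2norm y.
Proof.
have [APA _ APh _] := pinvP A; set P := Defs.pinv A in APA APh *.
apply: le_of_sqr_le; rewrite ?l2norm_ge0//.
apply: le_trans (cauchy_schwarz y _).
have -> : y^t* *m (A *m (P *m y)) = (A *m (P *m y))^t* *m (A *m (P *m y)).
  by rewrite (mulmxA A) trmxCM APh -(mulmxA (y^t*)) (mulmxA (A *m P) (A *m P))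
    (mulmxA (A *m P) A P) APA.
by rewrite dotmx_self normcR ger0_norm ?sqr_ge0.
Qed.

Lemma pinv_quad n (A : 'M[R[i]]_n) (u : 'cV_n) : A^t* = A ->
  (A *m u)^t* *m (Defs.pinv A *m (A *m u)) = u^t* *m (A *m u).
Proof.
have [APA _ _ _] := pinvP A => Ah.
by rewrite trmxCM Ah -(mulmxA _ A) !(mulmxA A) (mulmxA _ A) APA.
Qed.

End EuclideanNorm.

(** * Norm estimates for B^* D B and its pseudoinverse *)

Section WeightedGram.
Local Open Scope complex_scope.
Local Open Scope sesquilinear_scope.
Variables (R : realType) (m n : nat) (B : 'M[R[i]]_(m, n)) (f : 'I_m -> R).
Local Notation normc := (@ComplexField.Normc.normc R).

Definition wgram : 'M[R[i]]_n := B^t* *m diag_mx (\row_j (f j)%:C) *m B.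

Hypothesis f_gt0 : forall j, 0 < f j.

Lemma wgram_herm : wgram^t* = wgram.
Proof. by rewrite /wgram !trmxCM trmxC_K diag_mx_real_herm mulmxA. Qed.

Lemma wgram_quad (x : 'cV_n) :
  (x^t* *m (wgram *m x)) 0 0 = (\sum_j f j * normc ((B *m x) j 0) ^+ 2)%:C.
Proof.
rewrite /wgram !mulmxA -trmxCM -!mulmxA (mulmxA (diag_mx _)) mulmxA.
rewrite -!mulmxA rmorph_sum mxE.
apply: eq_bigr => j _; rewrite mul_diag_mx /= rmorphM /= sqr_normc_conj.
by rewrite mulrCA [_^t* _ _]mxE [_^T _ _]mxE [(\matrix_(_, _) _) _ _]mxE
  [_ 0 j]mxE.
Qed.

(** Since |B x|^2 = <x, B^* B x>, the bound [b] for B^* passes to [B]; the three factors of [wgram]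
    then contribute [b], [fM] and [b]. *)
Lemma specnorm_wgram_le (fM b : R) : (forall j, f j <= fM) -> 0 <= b ->
  0 <= fM ->
  (forall c : 'cV_m, l2norm (B^t* *m c) <= b * l2norm c) ->
  specnorm wgram <= fM * b ^+ 2.
Proof.
move=> fM_ge b0 fM0 Bb.
have bx (x : 'cV_n) : l2norm (B *m x) <= b * l2norm x.
  apply: le_of_sqr_le; rewrite ?mulr_ge0 ?l2norm_ge0//.
  have := cauchy_schwarz x (B^t* *m (B *m x)).
  rewrite mulmxA -trmxCM dotmx_self normcR ger0_norm ?sqr_ge0//.
  move=> /le_trans; apply; rewrite mulrAC [leRHS]mulrC ler_wpM2l ?l2norm_ge0//.
apply: specnorm_le; first by rewrite mulr_ge0 ?sqr_ge0.
move=> x; rewrite /wgram -!mulmxA; apply: le_trans (Bb _) _.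
rewrite [fM * _]mulrC expr2 -!mulrA ler_wpM2l//.
apply: (@le_trans _ _ (fM * l2norm (B *m x))); last first.
  by rewrite [leRHS]mulrCA ler_wpM2l.
rewrite -(@ler_pXn2r _ 2)// ?nnegrE ?mulr_ge0 ?l2norm_ge0//.
rewrite exprMn !sqr_l2norm mulr_sumr; apply: ler_sum => j _.
rewrite mul_diag_mx !mxE ComplexField.Normc.normcM exprMn.
rewrite ler_wpM2r ?sqr_ge0// normcR ler_pXn2r ?nnegrE//.
by rewrite ger0_norm// ltW.
Qed.

(** Let H be [wgram] and P its pseudoinverse. A vector x = P y lies in the range of B^*, where [B]
    inherits the lower bound [a]. Hence fm a^2 |x|^2 <= <x, H x> <= |x| |H x| <= |x| |y|. *)
Lemma specnorm_pinv_wgram_le (fm a : R) : (forall j, fm <= f j) -> 0 < a ->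
  0 < fm ->
  (forall c : 'cV_m, a * l2norm c <= l2norm (B^t* *m c)) ->
  specnorm (Defs.pinv wgram) <= (fm * a ^+ 2)^-1.
Proof.
move=> fm_le a0 fm0 aB.
have [_ PHP _ PHh] := pinvP wgram.
have k0 : 0 < fm * a ^+ 2 by rewrite mulr_gt0// exprn_gt0.
apply: specnorm_le => [|y]; first by rewrite invr_ge0 ltW.
rewrite mulrC ler_pdivlMr//.
set P := Defs.pinv wgram in PHP PHh *; set x := P *m y.
(* x = P H P y, and P H = H P^* because P H and H are hermitian; so x lies in the range of H. *)
have [c xE] : exists c : 'cV_m, x = B^t* *m c.
  exists (diag_mx (\row_j (f j)%:C) *m B *m (P^t* *m x)).
  rewrite !mulmxA -/wgram -{1}wgram_herm -trmxCM.
  by rewrite PHh PHP.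
have Hx : l2norm (wgram *m x) <= l2norm y by exact: l2norm_pinv_proj.
(* |x|^2 = <c, B x> <= |c| |B x|, while a |c| <= |B^* c| = |x|. *)
have Bx : a * l2norm x <= l2norm (B *m x).
  have [x0|x0] := eqVneq (l2norm x) 0; first by rewrite x0 mulr0 l2norm_ge0.
  have xp : 0 < l2norm x by rewrite lt_neqAle eq_sym x0 l2norm_ge0.
  rewrite -(ler_pM2r xp) -mulrA -expr2.
  have h : l2norm x ^+ 2 <= l2norm c * l2norm (B *m x).
    apply: le_trans (cauchy_schwarz c _).
    by rewrite mulmxA -{1}(trmxC_K B) -trmxCM -xE dotmx_self normcR ger0_norm
      ?sqr_ge0.
  apply: le_trans (ler_wpM2l (ltW a0) h) _.
  rewrite mulrA [leRHS]mulrC ler_wpM2r ?l2norm_ge0//.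
  by rewrite xE.
apply: le_of_sqr_le; rewrite ?l2norm_ge0//.
  by rewrite mulr_ge0 ?l2norm_ge0// ltW.
have q1 := cauchy_schwarz x (wgram *m x).
rewrite wgram_quad normcR ger0_norm in q1; last first.
  by apply: sumr_ge0 => j _; rewrite mulr_ge0 ?sqr_ge0// ltW.
have q2 : fm * l2norm (B *m x) ^+ 2 <= l2norm x * l2norm (wgram *m x).
  apply: le_trans q1; rewrite sqr_l2norm mulr_sumr; apply: ler_sum => j _.
  by rewrite ler_wpM2r ?sqr_ge0.
have q3 : (a * l2norm x) ^+ 2 <= l2norm (B *m x) ^+ 2.
  by rewrite ler_pXn2r// ?nnegrE ?mulr_ge0 ?l2norm_ge0// ltW.
have q4 := ler_wpM2l (ltW fm0) q3.
have q5 := ler_wpM2l (l2norm_ge0 x) Hx.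
have := ler_wpM2l (ltW k0) (le_trans (le_trans q4 q2) q5).
by rewrite !expr2; lra.
Qed.

Lemma sqr_l2norm_gram (s : R) (j : 'I_m) :
  (B *m B^t*) j j = s%:C -> l2norm (B^t* *m delta_mx j (0 : 'I_1)) ^+ 2 = s.
Proof.
move=> Bs; apply: (@complexI R); rewrite -dotmx_self trmxCM trmxC_K -mulmxA.
rewrite (_ : B *m (_ *m _) = col j (B *m B^t*)); last by rewrite mulmxA -colE.
rewrite mxE (bigD1 j)//= big1 => [|l lj].
  by rewrite [col _ _ _ _]mxE Bs !mxE !eqxx conjC1 mul1r addr0.
by rewrite [_^t* _ _]mxE [_^T _ _]mxE mxE (negbTE lj) conjC0 mul0r.
Qed.

(** The test vector B^* e_j has squared norm [s], and the j-th term alone makes the quadratic form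
    at least f_j s^2. *)
Lemma specnorm_wgram_ge (s : R) (j : 'I_m) : 0 < s ->
  (B *m B^t*) j j = s%:C -> s * f j <= specnorm wgram.
Proof.
move=> s0 Bs; pose x : 'cV_n := B^t* *m delta_mx j 0.
have Bx : (B *m x) j 0 = s%:C by rewrite /x mulmxA -colE mxE Bs.
have nx : l2norm x ^+ 2 = s.
  exact: sqr_l2norm_gram.
have := normc_quad_le_specnorm wgram x.
rewrite wgram_quad normcR ger0_norm; last first.
  by apply: sumr_ge0 => l _; rewrite mulr_ge0 ?sqr_ge0// ltW.
rewrite nx (bigD1 j)//= Bx normcR (ger0_norm (ltW s0)) => h.
have h2 : 0 <= \sum_(l | l != j) f l * normc ((B *m x) l 0) ^+ 2.
  by apply: sumr_ge0 => l _; rewrite mulr_ge0 ?sqr_ge0// ltW.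
rewrite -(ler_pM2r s0); move: h h2; rewrite expr2.
by set X := specnorm _; set Y := \sum_(_ | _) _; lra.
Qed.

(** With H = [wgram], the pseudoinverse is tested at H u = f_j B^* e_j: the squared norm is f_j^2 s,
    and by [pinv_quad] the form has the value u^* H u = f_j. *)
Lemma specnorm_pinv_wgram_ge (s : R) (j : 'I_m) (u : 'cV_n) : 0 < s ->
  (B *m B^t*) j j = s%:C -> B *m u = delta_mx j 0 ->
  (s * f j)^-1 <= specnorm (Defs.pinv wgram).
Proof.
move=> s0 Bs Bu; have fj := f_gt0 j.
have HuE : wgram *m u = (f j)%:C *: (B^t* *m delta_mx j 0).
  rewrite /wgram -!mulmxA Bu scalemxAr; congr (_ *m _).
  apply/colP => l; rewrite mul_diag_mx !mxE.
  by case: eqVneq => [->|_]; rewrite ?mulr0.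
have nx : l2norm (wgram *m u) ^+ 2 = f j ^+ 2 * s.
  by rewrite HuE l2normZ normcR exprMn ger0_norm ?ltW// (sqr_l2norm_gram Bs).
have := normc_quad_le_specnorm (Defs.pinv wgram) (wgram *m u).
rewrite nx pinv_quad ?wgram_herm// wgram_quad normcR Bu (bigD1 j)//=.
rewrite big1 => [|l lj]; last first.
  by rewrite mxE (negbTE lj) ComplexField.Normc.normc0 expr0n mulr0.
rewrite mxE !eqxx ComplexField.Normc.normc1 expr1n mulr1 addr0.
rewrite (ger0_norm (ltW fj)) => h.
rewrite -[leLHS]mul1r ler_pdivrMr ?mulr_gt0//.
rewrite -(ler_pM2r fj); move: h; rewrite expr2; set X := specnorm _; lra.
Qed.

End WeightedGram.

(** * The B-spline kernel *)

Section NumericBounds.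
Variable R : realType.

(** From the second term on, the sum is dominated by a telescoping one. *)
Lemma zeta_partial_le (k : nat) (h : R) (L : nat) : 0 <= h ->
  (forall i : nat, (i.+2%:R ^- k : R) <= h * (i.+1%:R^-1 - i.+2%:R^-1)) ->
  \sum_(i < L) i.+1%:R ^- k <= 1 + h.
Proof.
move=> h0 hk.
suff H n : \sum_(i < n.+1) (i.+1%:R ^- k : R) <= 1 + h * (1 - n.+1%:R^-1).
  case: L => [|L]; first by rewrite big_ord0 addr_ge0.
  apply: le_trans (H L) _; rewrite lerD2l ler_piMr// gerBl invr_ge0.
elim: n => [|n IH].
  by rewrite big_ord_recr big_ord0 /= expr1n invr1 subrr mulr0 add0r addr0.
rewrite big_ord_recr /=; move: IH (hk n).
set S := \sum_(_ < _) _; set u := n.+2%:R ^- k.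
by set a := n.+1%:R^-1; set b := n.+2%:R^-1; lra.
Qed.

Lemma zeta2_partial_le (L : nat) : \sum_(i < L) (i.+1%:R ^- 2 : R) <= 2.
Proof.
rewrite -[leRHS]/(1 + 1); apply: zeta_partial_le => // i.
have h1 : (0 : R) < i.+1%:R by rewrite ltr0n.
have h2 : (i.+2%:R : R) = i.+1%:R + 1 by rewrite natr1.
rewrite mul1r h2; move: h1; set x : R := i.+1%:R => x0.
have -> : x^-1 - (x + 1)^-1 = (x * (x + 1))^-1 by field; lra.
by rewrite lef_pV2 ?posrE ?exprn_gt0 ?mulr_gt0 ?addr_gt0// expr2 ler_wpM2r; lra.
Qed.

Lemma zeta3_partial_le (k L : nat) : (3 <= k)%N ->
  \sum_(i < L) (i.+1%:R ^- k : R) <= 3 / 2.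
Proof.
move=> k3; rewrite (_ : 3 / 2 = 1 + 1 / 2); last by lra.
apply: zeta_partial_le => [|i]; first lra.
have h1 : (1 : R) <= i.+1%:R by rewrite ler1n.
have h2 : (i.+2%:R : R) = i.+1%:R + 1 by rewrite natr1.
rewrite h2; move: h1; set x : R := i.+1%:R => x1.
have -> : 1 / 2 * (x^-1 - (x + 1)^-1) = (2 * x * (x + 1))^-1 by field; lra.
have p3 : 0 < 2 * x * (x + 1) by rewrite !mulr_gt0//; lra.
rewrite lef_pV2 ?posrE ?exprn_gt0//; last lra.
apply: (@le_trans _ _ ((x + 1) ^+ 3)); last by rewrite ler_weXn2l//; lra.
rewrite (exprSr _ 2) ler_wpM2r ?expr2; nra.
Qed.

Lemma bernoulli_ineq (x : R) n : -1 <= x -> 1 + n%:R * x <= (1 + x) ^+ n.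
Proof.
move=> x1; elim: n => [|n IH]; first by rewrite mul0r addr0 expr0.
have x2 : 0 <= 1 + x by lra.
have := ler_wpM2l x2 IH; rewrite exprS -natr1.
have : 0 <= (n%:R : R) by rewrite ler0n.
set N : R := n%:R => N0; nra.
Qed.

(** Induction by (1 + y) (1 - (n + 1) y) = 1 - n y - (n + 1) y^2. It bounds (1 + y)^n from above
    when n y < 1. *)
Lemma expr1D_mul_le (y : R) n : 0 <= y -> (1 + y) ^+ n * (1 - n%:R * y) <= 1.
Proof.
move=> y0; elim: n => [|n IH]; first by rewrite mul0r subr0 expr0 mul1r.
apply: le_trans IH; rewrite exprSr -mulrA ler_wpM2l ?exprn_ge0//; first lra.
have : 0 <= (n%:R : R) by rewrite ler0n.
rewrite -natr1; set N : R := n%:R => N0; nra.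
Qed.

Lemma exprB_le (a b : R) n : 0 <= b -> b <= a ->
  a ^+ n - b ^+ n <= n%:R * (a - b) * a ^+ n.-1.
Proof.
move=> b0 ba; elim: n => [|n IH]; first by rewrite !expr0 subrr !mul0r.
have a0 := le_trans b0 ba.
have -> : a ^+ n.+1 - b ^+ n.+1 = a * (a ^+ n - b ^+ n) + (a - b) * b ^+ n.
  by rewrite !exprS; ring.
have h1 : (a - b) * b ^+ n <= (a - b) * a ^+ n.
  by rewrite ler_wpM2l ?subr_ge0// lerXn2r.
have h2 := ler_wpM2l a0 IH.
case: n IH h1 h2 => [|n] IH h1 h2; first by move: h1 h2; rewrite !expr0 /=; lra.
move: h1 h2; rewrite -[n.+2%:R]natr1 /= !exprS.
set N : R := n.+1%:R; set A := a ^+ n; set B := b ^+ n; lra.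
Qed.

(* The Bernoulli inequality [d <= (2 d / (d + 1)) ^ (d + 1)] is what makes the
   constant [2 d] in the theorem sufficient. *)
Lemma cell_sum_le (d L : nat) (eps c : R) : (0 < d)%N -> 0 <= eps <= 1 ->
  c = eps * (d.+1%:R / (4 * d%:R)) ^+ d.+1 ->
  (2 + 2 * c * \sum_(i < L) i.+1%:R ^- d.+1) ^+ d - 2 ^+ d <= eps.
Proof.
move=> d0 /andP[e0 e1] cdef; set Z := \sum_(_ < _) _.
have D0 : 0 < (d%:R : R) by rewrite ltr0n.
have dS : (d.+1%:R : R) = d%:R + 1 by rewrite natr1.
have Z0 : 0 <= Z.
  by apply: sumr_ge0 => i _; rewrite invr_ge0 exprn_ge0// ler0n.
pose r : R := 2 * d%:R / d.+1%:R.
have r0 : 0 < r by rewrite !mulr_gt0// ?invr_gt0 ltr0n.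
have rB : d%:R <= r ^+ d.+1.
  have -> : r = 1 + (d%:R - 1) / d.+1%:R by rewrite /r dS; field; lra.
  have hx : -1 <= (d%:R - 1) / (d.+1%:R : R).
    by rewrite ler_pdivlMr ?ltr0n// dS; lra.
  apply: le_trans (bernoulli_ineq _ hx).
  by rewrite mulrCA mulfV ?pnatr_eq0// mulr1; lra.
have cE : c * (2 ^+ d.+1 * r ^+ d.+1) = eps.
  rewrite cdef -mulrA -!exprMn (_ : _ / _ * (2 * r) = 1) ?expr1n ?mulr1//.
  by rewrite /r dS; field; lra.
have rp : 0 < r ^+ d.+1 by rewrite exprn_gt0.
have p2 : 0 < (2 : R) ^+ d.+1 by rewrite exprn_gt0.
have c0 : 0 <= c.
  by rewrite cdef mulr_ge0// exprn_ge0// divr_ge0 ?ler0n// mulr_ge0// ler0n.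
have cd : c * 2 ^+ d.+1 * d%:R <= 1.
  apply: le_trans e1; rewrite -cE mulrA ler_wpM2l// mulr_ge0// ltW//.
have cZ0 : 0 <= c * Z by rewrite mulr_ge0.
(* By [exprB_le] the difference is at most 2^d d c Z (1 + c Z)^(d - 1), and eps = c 2^(d + 1) r^(d +
   1) >= 2^(d + 1) d c, so this estimate suffices. For d = 1 it bounds the partial sums of zeta(2);
   for d >= 2 one has Z <= 3/2, and the power is at most 4/3. *)
have key : Z * (1 + c * Z) ^+ d.-1 <= 2.
  case: d d0 {cdef} D0 dS @r r0 @Z Z0 rB cE rp p2 c0 cd cZ0 => [//|[|d]] _ D0 dS r
    r0 Z Z0 rB cE rp p2 c0 cd cZ0.
    by rewrite expr0 mulr1; exact: zeta2_partial_le.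
  have Z32 : Z <= 3 / 2 by exact: zeta3_partial_le.
  pose y := c * (3 / 2).
  have y0 : 0 <= y by rewrite mulr_ge0//; lra.
  have yd : d.+1%:R * y <= 1 / 4.
    have h8 : (8 : R) <= 2 ^+ d.+3.
      rewrite (_ : 8 = 2 ^+ 3); last by rewrite -natrX.
      by rewrite ler_weXn2l// ler1n.
    have h1 : c * d.+2%:R * 8 <= 1.
      apply: le_trans cd; rewrite mulrAC ler_wpM2r ?ler0n//.
      by rewrite ler_wpM2l.
    have h2 : (d.+1%:R : R) <= d.+2%:R by rewrite ler_nat.
    have h3 := ler_wpM2l c0 h2.
    by rewrite /y; lra.
  have h4 := expr1D_mul_le d.+1 y0.
  have h5 : (1 + c * Z) ^+ d.+1 <= (1 + y) ^+ d.+1.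
    by rewrite lerXn2r ?nnegrE ?addr_ge0// lerD2l ler_wpM2l.
  have h6 : 0 <= (1 + y) ^+ d.+1 by rewrite exprn_ge0// addr_ge0.
  have h7 : 0 <= (1 + c * Z) ^+ d.+1 by rewrite exprn_ge0// addr_ge0.
  rewrite [d.+2.-1]/=; move: h4 h5 h6 h7 yd Z32.
  set E := (1 + y) ^+ _; set F := (1 + c * Z) ^+ _; set w := _ * y.
  move=> h4 h5 h6 h7 yd Z32.
  have h8 : E * (3 / 4) <= 1 by apply: le_trans h4; rewrite ler_wpM2l//; lra.
  have h9 : Z * F <= 3 / 2 * F by rewrite ler_wpM2r.
  lra.
have -> : 2 + 2 * c * Z = 2 * (1 + c * Z) by ring.
rewrite exprMn -{2}[2 ^+ d]mulr1 -mulrBr.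
have h1 : (1 : R) <= 1 + c * Z by lra.
have := exprB_le d ler01 h1; rewrite expr1n [1 + _ - 1]addrAC subrr add0r => h2.
have p2' : 0 < (2 : R) ^+ d by rewrite exprn_gt0.
have h3 := ler_wpM2l (ltW p2') h2; apply: le_trans h3 _.
have -> : 2 ^+ d * (d%:R * (c * Z) * (1 + c * Z) ^+ d.-1) =
  c * 2 ^+ d * d%:R * (Z * (1 + c * Z) ^+ d.-1) by ring.
rewrite -cE (exprS 2 d).
have -> : c * (2 * 2 ^+ d * r ^+ d.+1) = c * 2 ^+ d * r ^+ d.+1 * 2 by ring.
apply: ler_pM => //.
- by rewrite !mulr_ge0// ltW.
- by rewrite mulr_ge0// exprn_ge0// addr_ge0.
- by rewrite ler_wpM2l// mulr_ge0// ltW.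
Qed.

End NumericBounds.

(** * Jordan's inequality, Dirichlet kernels and spline kernels *)

Section Kernel.
Local Open Scope complex_scope.
Variable R : realType.
Local Notation normc := (@ComplexField.Normc.normc R).

(** The function sin(pi y) - 2 y vanishes at 0 and 1/2. If it were negative at x, the mean value
    theorem would give points a < x < b with negative derivative at a and positive derivative at b,
    but cos decreases on [0, pi]. *)
Lemma jordan_sin (x : R) : 0 <= x <= 1 / 2 -> 2 * x <= sin (pi * x).
Proof.
move=> /andP[x0 x1]; have pi0 := pi_gt0 R.
have [//|hlt] := leP (2 * x) (sin (pi * x)).
pose f (y : R) := sin (pi * y) - 2 * y.
pose df (y : R) := pi * cos (pi * y) - 2.
have fd (y : R) : is_derive y (1 : R) f (df y).
  have h : is_derive y (1 : R) (fun z : R => pi * z) pi.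
    by have := is_deriveZ pi (is_derive_id y 1); rewrite /GRing.scale /= mulr1.
  have h2 := is_derive1_comp (is_derive_sin (pi * y)) h.
  have h3 : is_derive y (1 : R) (fun z : R => 2 * z) 2.
    by have := is_deriveZ 2 (is_derive_id y 1); rewrite /GRing.scale /= mulr1.
  by have := is_deriveB h2 h3; rewrite /GRing.scale /= mulrC.
have fc (y : R) : {for y, continuous f}.
  by apply: differentiable_continuous; apply/derivable1_diffP; apply: ex_derive.
have f0 : f 0 = 0 by rewrite /f !mulr0 sin0 subrr.
have fh : f (1 / 2) = 0.
  by rewrite /f mulrA mulr1 sin_pihalf mulrA mulr1 divff ?subrr// pnatr_eq0.
have fx : f x < 0 by rewrite /f subr_lt0.
have xp : 0 < x.
  by rewrite lt_neqAle x0 andbT; apply: contraTneq fx => <-; rewrite f0 ltxx.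
have xh : x < 1 / 2.
  by rewrite lt_neqAle x1 andbT; apply: contraTneq fx => ->; rewrite fh ltxx.
have [a] := MVT xp (fun y _ => fd y) (continuous_subspaceT fc).
have [b] := MVT xh (fun y _ => fd y) (continuous_subspaceT fc).
rewrite !in_itv /= fh f0 subr0 sub0r => /andP[b1 b2] hb /andP[a1 a2] ha.
have : cos (pi * b) < cos (pi * a).
  rewrite ltr_cos ?in_itv /= ?ltr_pM2l//; first exact: lt_trans a2 b1.
  - by rewrite mulr_ge0 ?ler_piMr//; lra.
  - by rewrite mulr_ge0 ?ler_piMr//; lra.
rewrite -(ltr_pM2l pi0) => hab.
have da : df a < 0 by rewrite -(pmulr_llt0 _ xp); move: ha; rewrite subr0 => <-.
have db : 0 < df b.
  by rewrite -(@pmulr_lgt0 _ (1 / 2 - x)) ?subr_gt0// -hb oppr_gt0.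
by move: hab da db; rewrite /df; lra.
Qed.

Lemma normc_cis2pi (s : R) : normc (cis2pi s) = 1.
Proof. by rewrite /= cos2Dsin2 sqrtr1. Qed.

Lemma cis2piD (s u : R) : cis2pi (s + u) = cis2pi s * cis2pi u.
Proof.
apply/eqP; rewrite eq_complex /= mulrDr cosD sinD eqxx /=; apply/eqP; ring.
Qed.

Lemma cis2pi0 : cis2pi (0 : R) = 1.
Proof. by rewrite /cis2pi mulr0 cos0 sin0. Qed.

Lemma cis2piMn (s : R) n : cis2pi (n%:R * s) = cis2pi s ^+ n.
Proof.
elim: n => [|n IH]; first by rewrite mul0r cis2pi0 expr0.
by rewrite -natr1 mulrDl mul1r cis2piD IH exprSr.
Qed.

Lemma cis2piN (s : R) : cis2pi (- s) = (cis2pi s)^*.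
Proof. by rewrite /cis2pi mulrN cosN sinN. Qed.

Lemma cis2pi_nat n : cis2pi (n%:R : R) = 1.
Proof.
rewrite -[n%:R]mulr1 cis2piMn (_ : cis2pi 1 = 1) ?expr1n//.
by rewrite /cis2pi mulr1 mulr_natl cos2pi sin2pi.
Qed.

Lemma cis2pi_int (r : int) : cis2pi (r%:~R : R) = 1.
Proof.
case: r => n; first exact: cis2pi_nat.
by rewrite NegzE mulrNz cis2piN cis2pi_nat conjc1.
Qed.

(** |e^(2 pi i x) - 1| = 2 |sin(pi x)|, and Jordan's inequality applies. *)
Lemma normc_cis2piB1 (x : R) : `|x| <= 1 / 2 -> 4 * `|x| <= normc (cis2pi x - 1).
Proof.
move=> xh.
have -> : normc (cis2pi x - 1) = 2 * `|sin (pi * x)|.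
  rewrite /= subr0 (_ : 2 * pi * x = (pi * x) *+ 2); last by rewrite mulr2n; ring.
  have -> : (cos ((pi * x) *+ 2) - 1) ^+ 2 + sin ((pi * x) *+ 2) ^+ 2 =
      (2 * sin (pi * x)) ^+ 2.
    have h1 := cos2Dsin2 ((pi * x) *+ 2); have h2 := cos_mulr2n (pi * x).
    have h3 := cos2Dsin2 (pi * x); rewrite -mulr_natr in h2.
    by rewrite exprMn; nra.
  by rewrite sqrtr_sqr normrM ger0_norm.
rewrite (_ : 4 = 2 * 2); last by rewrite -natrM.
rewrite -mulrA ler_wpM2l//.
have [x0|x0] := leP 0 x.
  rewrite (ger0_norm x0) in xh *; apply: le_trans (ler_norm _).
  by apply: jordan_sin; rewrite x0.
rewrite (ltr0_norm x0) in xh *; rewrite -normrN -sinN -mulrN.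
by apply: le_trans (ler_norm _); apply: jordan_sin; rewrite xh oppr_ge0 ltW.
Qed.

Definition dirichlet (m : nat) : {poly R} := \poly_(i < m) 1.

(* A discrete B-spline of order [b]; the last factor brings the degree up to
   [n]. *)
Definition bspline (b n : nat) : {poly R} :=
  dirichlet (n %/ b).+1 ^+ b * dirichlet (n %% b).+1.

(** Positivity holds up to the exact degree, without gaps: the coefficients become squared weights,
    which must be positive at every index. *)
Definition pos_coefs (p : {poly R}) (a : nat) :=
  (size p = a.+1) /\ (forall i, (i <= a)%N -> 0 < p`_i).

Lemma pos_coefs_ge0 p a i : pos_coefs p a -> 0 <= p`_i.
Proof.
move=> [sp hp]; case: (leqP i a) => ia; first exact/ltW/hp.
by rewrite nth_default ?sp.
Qed.

Lemma pos_coefsM p q a b :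
  pos_coefs p a -> pos_coefs q b -> pos_coefs (p * q) (a + b).
Proof.
move=> hp hq; have [[sp pp] [sq qq]] := (hp, hq); split.
  rewrite size_mul -?size_poly_gt0 ?sp ?sq//.
  by rewrite addSn addnS.
move=> i iab; rewrite coefM.
(* The term with j = min(i, a) is positive, since then i - j <= b; the others are nonnegative. *)
have mi : (minn i a < i.+1)%N by rewrite ltnS geq_minl.
rewrite (bigD1 (Ordinal mi))//=; apply: ltr_pwDl.
  apply: mulr_gt0; first by apply: pp; rewrite geq_minr.
  apply: qq; rewrite leq_subLR /minn; case: ltnP => // ia.
  by rewrite leq_addr.
apply: sumr_ge0 => j _; apply: mulr_ge0.
  exact: pos_coefs_ge0 hp.
exact: pos_coefs_ge0 hq.
Qed.

Lemma pos_coefs_dirichlet m : pos_coefs (dirichlet m.+1) m.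
Proof.
split=> [|i im]; first by rewrite size_poly_eq ?oner_neq0.
by rewrite coef_poly ltnS im.
Qed.

Lemma pos_coefs_bspline b n : (0 < b)%N -> pos_coefs (bspline b n) n.
Proof.
move=> b0; have H k m : pos_coefs (dirichlet m.+1 ^+ k) (k * m).
  elim: k => [|k IH].
    by split=> [|[|i]//]; rewrite expr0 ?size_poly1 ?coef1.
  by rewrite exprS mulSn; apply: pos_coefsM => //; exact: pos_coefs_dirichlet.
rewrite {2}(divn_eq n b) mulnC.
exact: pos_coefsM (H _ _) (pos_coefs_dirichlet _).
Qed.

Definition evalc (p : {poly R}) (z : R[i]) : R[i] :=
  (map_poly (real_complex R) p).[z].

Lemma evalc_dirichlet m z : evalc (dirichlet m) z = \sum_(i < m) z ^+ i.
Proof.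
rewrite /evalc (_ : map_poly _ _ = \poly_(i < m) 1) ?horner_poly.
  by apply: eq_bigr => i _; rewrite mul1r.
by apply/polyP => i; rewrite coef_map !coef_poly /=; case: ifP.
Qed.

Lemma evalcM p q z : evalc (p * q) z = evalc p z * evalc q z.
Proof. by rewrite /evalc rmorphM hornerM. Qed.

Lemma evalcX p k z : evalc (p ^+ k) z = evalc p z ^+ k.
Proof. by rewrite /evalc rmorphXn horner_exp. Qed.

Lemma evalcE p a z : pos_coefs p a ->
  evalc p z = \sum_(i < a.+1) (p`_i)%:C * z ^+ i.
Proof.
move=> [sp _]; rewrite /evalc horner_coef size_map_poly sp.
by apply: eq_bigr => i _; rewrite coef_map.
Qed.

Lemma dirichlet_le_size m (x : R) :
  normc (evalc (dirichlet m) (cis2pi x)) <= m%:R.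
Proof.
rewrite evalc_dirichlet; apply: le_trans (ler_normc_sum _ _) _.
under eq_bigr do rewrite normcX normc_cis2pi expr1n.
by rewrite sumr_const card_ord.
Qed.

(** Multiplied by z - 1, the geometric sum becomes z^m - 1, of modulus at most 2, while |z - 1| >= 4
    |x|. *)
Lemma dirichlet_decay m (x : R) : `|x| <= 1 / 2 ->
  normc (evalc (dirichlet m) (cis2pi x)) * (2 * `|x|) <= 1.
Proof.
move=> xh; rewrite evalc_dirichlet; set S := \sum_(_ < _) _.
have : normc (cis2pi x - 1) * normc S <= 2.
  rewrite -ComplexField.Normc.normcM -subrX1 -lecR -norm_normc.
  apply: le_trans (ler_normB _ _) _.
  rewrite !norm_normc normcX normc_cis2pi expr1n ComplexField.Normc.normc1.
  by rewrite -rmorphD.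
have := ler_wpM2r (normc_ge0 S) (normc_cis2piB1 xh).
by set u := `|x|; set v := normc S; lra.
Qed.

Lemma bspline_at1 b n :
  (bspline b n).[1] = (n %/ b).+1%:R ^+ b * (n %% b).+1%:R.
Proof.
have H m : (dirichlet m).[1] = m%:R.
  rewrite horner_poly; under eq_bigr do rewrite mul1r expr1n.
  by rewrite sumr_const card_ord.
by rewrite hornerM horner_exp !H.
Qed.

Lemma bspline_le_at1 b n (x : R) :
  normc (evalc (bspline b n) (cis2pi x)) <= (bspline b n).[1].
Proof.
rewrite bspline_at1 evalcM evalcX ComplexField.Normc.normcM normcX.
apply: ler_pM; rewrite ?exprn_ge0 ?normc_ge0 ?dirichlet_le_size//.
by rewrite lerXn2r ?nnegrE ?normc_ge0 ?dirichlet_le_size.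
Qed.

(** Each of the [b] equal Dirichlet factors has m = floor(n / b) + 1 terms. As n <= b m, its bound 1
    / (2 y) is at most m b / (2 n y). The last factor is bounded by its value at 1. *)
Lemma bspline_decay b n (x y : R) : (0 < b)%N -> (0 < n)%N ->
  0 < y -> y <= `|x| -> `|x| <= 1 / 2 ->
  normc (evalc (bspline b n) (cis2pi x)) <=
    (b%:R / (2 * n%:R * y)) ^+ b * (bspline b n).[1].
Proof.
move=> b0 n0 y0 yx xh.
have nR : 0 < (n%:R : R) by rewrite ltr0n.
have bR : 0 < (b%:R : R) by rewrite ltr0n.
rewrite bspline_at1 mulrA -exprMn evalcM evalcX ComplexField.Normc.normcM normcX.
apply: ler_pM; rewrite ?exprn_ge0 ?normc_ge0 ?dirichlet_le_size//.
rewrite lerXn2r ?nnegrE ?normc_ge0//.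
  by rewrite mulr_ge0 ?divr_ge0 ?mulr_ge0 ?ler0n// ltW.
set m := (n %/ b).+1.
have hm : n%:R <= b%:R * (m%:R : R).
  by rewrite -natrM ler_nat mulnC ltnW// ltn_ceil.
have := dirichlet_decay m xh; set v := normc _ => hv.
have v0 : 0 <= v by exact: normc_ge0.
have hv2 : v * (2 * y) <= 1 by apply: le_trans hv; rewrite ler_wpM2l// ler_wpM2l.
rewrite mulrAC ler_pdivlMr ?mulr_gt0//.
apply: le_trans hm; rewrite -[leRHS]mulr1.
rewrite (_ : v * _ = n%:R * (v * (2 * y))); last by ring.
by rewrite ler_wpM2l// ltW.
Qed.

End Kernel.

(** * Condition numbers *)

Section Gershgorin.
Local Open Scope complex_scope.
Local Open Scope sesquilinear_scope.
Variables (R : realType) (m n : nat) (B : 'M[R[i]]_(m, n)).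
Local Notation normc := (@ComplexField.Normc.normc R).

(** Gershgorin's estimate for the quadratic form: 2 |c_j c_l| <= |c_j|^2 + |c_l|^2 in each
    off-diagonal term, and the symmetry of |G_jl| reduces both halves to row sums. *)
Lemma gram_dist_le (s e : R) :
  (forall j, (B *m B^t*) j j = s%:C) ->
  (forall j, \sum_(l | l != j) normc ((B *m B^t*) j l) <= e) ->
  forall c : 'cV_m,
    `|l2norm (B^t* *m c) ^+ 2 - s * l2norm c ^+ 2| <= e * l2norm c ^+ 2.
Proof.
move=> Gd Ge c; set G := B *m B^t* in Gd Ge.
have Gsym j l : normc (G j l) = normc (G l j).
  have Gh : G^t* = G by rewrite /G trmxCM trmxC_K.
  by rewrite -[in LHS]Gh !mxE normc_conj.
have E : (l2norm (B^t* *m c) ^+ 2)%:C =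
    \sum_j \sum_l (c j 0)^* * G j l * c l 0.
  rewrite -dotmx_self trmxCM trmxC_K mulmxA -(mulmxA _ B) -/G -mulmxA.
  rewrite mxE; apply: eq_bigr => j _; rewrite [(G *m c) _ _]mxE mulr_sumr.
  by apply: eq_bigr => l _; rewrite [_^t* _ _]mxE [_^T _ _]mxE mulrA.
have E2 : (l2norm (B^t* *m c) ^+ 2 - s * l2norm c ^+ 2)%:C =
    \sum_j \sum_(l | l != j) (c j 0)^* * G j l * c l 0.
  rewrite rmorphB /= E [X in (_ - X%:C)%C](_ : _ = \sum_j s * normc (c j 0) ^+ 2);
    last by rewrite sqr_l2norm mulr_sumr.
  rewrite rmorph_sum -sumrB; apply: eq_bigr => j _.
  rewrite (bigD1 j)//= Gd rmorphM /= sqr_normc_conj.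
  by rewrite addrAC mulrCA mulrA subrr add0r.
rewrite -normcR E2; apply: le_trans (ler_normc_sum _ _) _.
pose F j l := normc (c j 0) ^+ 2 * normc (G j l).
apply: (@le_trans _ _ (\sum_j \sum_(l | l != j) (F j l + F l j) / 2)).
  apply: ler_sum => j _; apply: le_trans (ler_normc_sum _ _) _.
  apply: ler_sum => l _; rewrite !ComplexField.Normc.normcM normc_conj.
  rewrite /F (Gsym l j) ler_pdivlMr// -mulrDl.
  have -> : normc (c j 0) * normc (G j l) * normc (c l 0) * 2 =
    2 * (normc (c j 0) * normc (c l 0)) * normc (G j l) by ring.
  rewrite ler_wpM2r ?normc_ge0//.
  by have := sqr_ge0 (normc (c j 0) - normc (c l 0)); rewrite sqrrB; lra.
have S : \sum_j \sum_(l | l != j) F l j = \sum_j \sum_(l | l != j) F j l.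
  rewrite (exchange_big_dep predT)//=; apply: eq_bigr => j _.
  by apply: eq_bigl => l; rewrite eq_sym.
under eq_bigr do rewrite -mulr_suml big_split /=.
rewrite -mulr_suml big_split /= S -mulr2n -[_ *+ 2]mulr_natr mulfK ?pnatr_eq0//.
rewrite sqr_l2norm mulr_sumr; apply: ler_sum => j _.
by rewrite /F -mulr_sumr mulrC ler_wpM2r ?sqr_ge0.
Qed.

(** A left kernel vector v satisfies B^* v^* = 0, and the lower bound forces v = 0. *)
Lemma row_free_of_bounded_below (a : R) : 0 < a ->
  (forall c : 'cV_m, a * l2norm c <= l2norm (B^t* *m c)) -> row_free B.
Proof.
move=> a0 h; rewrite -kermx_eq0; apply/eqP/row_matrixP => i.
rewrite row0; set v := row i _.
have vB : v *m B = 0 by apply/sub_kermxP; exact: row_sub.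
have := h (v^t*); rewrite -trmxCM vB.
rewrite (_ : (0 : 'M[R[i]]_(1, n))^t* = 0); last first.
  by apply/matrixP=> x y; rewrite !mxE conjC0.
rewrite l2norm0 pmulr_rle0// => v0.
have /l2norm0_eq0 v00 : l2norm (v^t*) = 0.
  by apply/eqP; rewrite eq_le v0 l2norm_ge0.
by rewrite -[v]trmxC_K v00; apply/matrixP=> x y; rewrite !mxE conjC0.
Qed.

End Gershgorin.

Section ConditionNumber.
Local Open Scope complex_scope.
Local Open Scope sesquilinear_scope.
Variables (R : realType) (m n : nat) (B : 'M[R[i]]_(m, n)) (f : 'I_m -> R).

(** The norm is at most fM s (1 + e), that of the pseudoinverse at most 1 / (fm s (1 - e)); the
    scale [s] cancels. *)
Lemma cond2_wgram_le (fm fM s e : R) :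
  0 < fm -> (forall j, fm <= f j <= fM) -> 0 <= fM -> 0 < s -> 0 <= e < 1 ->
  (forall c : 'cV_m, s * (1 - e) * l2norm c ^+ 2 <= l2norm (B^t* *m c) ^+ 2
      <= s * (1 + e) * l2norm c ^+ 2) ->
  cond2 (wgram B f) <= (1 + e) / (1 - e) * (fM / fm).
Proof.
move=> fm0 hf fM0 s0 /andP[e0 e1] hB.
have f0 j : 0 < f j by have /andP[h _] := hf j; exact: lt_le_trans h.
have a0 : 0 < s * (1 - e) by rewrite mulr_gt0// subr_gt0.
have b0 : 0 < s * (1 + e) by rewrite mulr_gt0// ltr_wpDr.
have h1 : specnorm (wgram B f) <= fM * (s * (1 + e)).
  rewrite -(sqr_sqrtr (ltW b0)).
  apply: (specnorm_wgram_le f0 _ (sqrtr_ge0 _) fM0) => [j|c].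
    by have /andP[] := hf j.
  have /andP[_ h] := hB c.
  rewrite -(@ler_pXn2r _ 2)// ?nnegrE ?mulr_ge0 ?sqrtr_ge0 ?l2norm_ge0//.
  by rewrite exprMn (sqr_sqrtr (ltW b0)).
have h2 : specnorm (Defs.pinv (wgram B f)) <= (fm * (s * (1 - e)))^-1.
  rewrite -(sqr_sqrtr (ltW a0)).
  have sa0 : 0 < Num.sqrt (s * (1 - e)) by rewrite sqrtr_gt0.
  apply: (specnorm_pinv_wgram_le f0 _ sa0 fm0) => [j|c].
    by have /andP[] := hf j.
  have /andP[h _] := hB c.
  rewrite -(@ler_pXn2r _ 2)// ?nnegrE ?mulr_ge0 ?sqrtr_ge0 ?l2norm_ge0//.
  by rewrite exprMn (sqr_sqrtr (ltW a0)).
apply: le_trans (ler_pM (specnorm_ge0 _) (specnorm_ge0 _) h1 h2) _.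
rewrite le_eqVlt; apply/orP; left; apply/eqP.
by field; rewrite !gt_eqF// subr_gt0.
Qed.

(** Full row rank supplies the preimage of e_l at which the pseudoinverse is tested; again [s]
    cancels. *)
Lemma cond2_wgram_ge (s : R) j l : (forall j, 0 < f j) -> 0 < s -> row_free B ->
  (forall j, (B *m B^t*) j j = s%:C) -> f j / f l <= cond2 (wgram B f).
Proof.
move=> f0 s0 fB Bs.
have u1 : B *m (pinvmx B *m delta_mx l (0 : 'I_1)) = delta_mx l 0.
  by rewrite mulmxA mulmxVp// mul1mx.
have h1 := specnorm_wgram_ge f0 s0 (Bs j).
have h2 := specnorm_pinv_wgram_ge f0 s0 (Bs l) u1.
apply: le_trans (ler_pM _ _ h1 h2).
- rewrite le_eqVlt; apply/orP; left; apply/eqP.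
  by field; rewrite !gt_eqF.
- by rewrite mulr_ge0// ltW.
- by rewrite invr_ge0 mulr_ge0// ltW.
Qed.

End ConditionNumber.

(** * Counting separated nodes *)

Section Cells.
Variables (R : realType) (d : nat).

(** The representative of [y] modulo 1 in [-1/2, 1/2). *)
Definition centered (y : R) : R := y - (Num.floor (y + 1 / 2))%:~R.

Lemma centered_le y : `|centered y| <= 1 / 2.
Proof.
have := Num.Theory.floor_itv (y + 1 / 2).
rewrite /centered intrD1 ler_norml => /andP[h1 h2].
by apply/andP; split; lra.
Qed.

Lemma cis2pi_centered y : cis2pi (centered y) = cis2pi y.
Proof. by rewrite cis2piD -mulrNz cis2pi_int mulr1. Qed.

(* A coordinate [x] is recorded by its sign and by the integer part of
   [|x| / q]. *)
Definition cell_bound (L : nat) (c : R) (p : bool * 'I_L.+1) : R :=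
  if p.2 == ord0 then 1 else c * (p.2%:R ^- d.+1).

Lemma sum_cell_bound L c :
  \sum_(p : bool * 'I_L.+1) cell_bound c p =
  2 + 2 * c * \sum_(i < L) i.+1%:R ^- d.+1.
Proof.
rewrite -(pair_bigA _ (fun b a => cell_bound c (b, a))) /=.
rewrite big_bool !big_ord_recl /cell_bound /= -!mulr_sumr; ring.
Qed.

(* The subtracted product is the indicator of the [2 ^ d] cells around the
   origin, which separation leaves empty.  With this form the sum over all cells
   factors over the coordinates. *)
Definition cell_excess (L : nat) (c : R)
    (F : {ffun 'I_d -> bool * 'I_L.+1}) : R :=
  \prod_i cell_bound c (F i) - \prod_i ((F i).2 == ord0)%:R.

(** This allows a sum over occupied cells to be extended to all cells. *)
Lemma cell_excess_ge0 L c F : 0 <= c -> 0 <= @cell_excess L c F.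
Proof.
move=> c0; rewrite subr_ge0; apply: ler_prod => i _.
rewrite ler0n /cell_bound; case: ifP => _ /=; first exact: lexx.
by rewrite mulr_ge0// invr_ge0 exprn_ge0.
Qed.

Lemma sum_cell_excess L c : \sum_F @cell_excess L c F =
  (2 + 2 * c * \sum_(i < L) i.+1%:R ^- d.+1) ^+ d - 2 ^+ d.
Proof.
rewrite sumrB -(bigA_distr_bigA (fun _ p => cell_bound c p)).
rewrite -(bigA_distr_bigA (fun _ (p : bool * 'I_L.+1) => (p.2 == ord0)%:R)).
rewrite !prodr_const card_ord sum_cell_bound; congr (_ - _ ^+ _).
rewrite -(pair_bigA _ (fun (b : bool) (a : 'I_L.+1) => (a == ord0)%:R)) /=.
by rewrite big_bool !big_ord_recl /= !big1// !addr0.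
Qed.

End Cells.

Section Separation.
Variables (R : realType) (d M : nat) (t : 'I_M -> 'rV[R]_d) (q : R).
Hypotheses (q_gt0 : 0 < q) (t_sep : q_separated q t).

Lemma separated_coord j l (r : 'I_d -> int) : j != l ->
  exists i, q < `|t j 0 i - t l 0 i + (r i)%:~R|.
Proof.
move=> jl; apply/existsP; apply: contraT; rewrite negb_exists => /forallP h.
have : (sep t <= (mx_norm (t j - t l + map_mx intr (\row_i r i)))%:E)%E.
  by apply: ereal_inf_lbound; exists (j, l, \row_i r i).
move=> /(lt_le_trans t_sep); rewrite lte_fin mx_normrE ltNge.
rewrite bigmax_le ?ltW// => -[a i] _ /=.
by rewrite !mxE ord1 leNgt; exact: h.
Qed.

(** Each node other than the j-th is sent to its cell. Separation makes this map injective and keeps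
    the cells around the origin empty, so the terms are dominated by [cell_excess] at distinct
    cells. *)
Lemma separated_row_sum (c : R) (j : 'I_M) (K : 'I_M -> R) : 0 <= c ->
  (forall l, l != j -> forall mu : 'I_d -> nat,
     (forall i, (mu i)%:R * q <= `|centered (t j 0 i - t l 0 i)|) ->
     K l <= \prod_i (if mu i == 0%N then 1 else c * (mu i)%:R ^- d.+1)) ->
  exists L : nat, \sum_(l | l != j) K l <=
    (2 + 2 * c * \sum_(i < L) i.+1%:R ^- d.+1) ^+ d - 2 ^+ d.
Proof.
(* Centered coordinates are at most 1/2 in modulus, so no integer part of |x| / q exceeds [L]. *)
move=> c0 hK; pose L := Num.truncn (1 / 2 / q); exists L.
pose x l i := centered (t j 0 i - t l 0 i).
pose mu l i := Num.truncn (`|x l i| / q).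
have muL l i : (mu l i < L.+1)%N.
  rewrite ltnS; apply: le_truncn.
  by rewrite ler_pM2r ?invr_gt0// centered_le.
have xq0 l i : 0 <= `|x l i| / q by rewrite divr_ge0// ltW.
have mule l i : (mu l i)%:R * q <= `|x l i|.
  by rewrite -ler_pdivlMr// truncn_le.
have mugt l i : `|x l i| < (mu l i).+1%:R * q.
  by rewrite -ltr_pdivrMr// truncnS_gt.
pose cell l : {ffun 'I_d -> bool * 'I_L.+1} :=
  [ffun i => (0 <= x l i, Ordinal (muL l i))].
have cell_inj : {in [set l | l != j]%SET &, injective cell}.
  move=> l l' _ _ /ffunP ell; apply: contraTeq isT => ll.
  (* This shift turns t_l - t_l' into the difference of the centered coordinates; equal signs and
     equal integer parts keep it within [q]. *)
  pose r i := Num.floor (t j 0 i - t l 0 i + 1 / 2) -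
    Num.floor (t j 0 i - t l' 0 i + 1 / 2).
  have [i +] := separated_coord r ll.
  rewrite ltNge => /negP[].
  have -> : t l 0 i - t l' 0 i + (r i)%:~R = x l' i - x l i.
    by rewrite /x /centered /r rmorphB /=; ring.
  have := ell i; rewrite !ffunE => -[sg mm].
  have := mugt l i; have := mugt l' i; have := mule l i; have := mule l' i.
  rewrite -mm -natr1 mulrDl mul1r.
  case: (leP 0 (x l i)) sg => h1; case: (leP 0 (x l' i)) => h2 // _.
    rewrite (ger0_norm h1) (ger0_norm h2) ler_norml => *.
    by apply/andP; split; lra.
  rewrite (ltr0_norm h1) (ltr0_norm h2) ler_norml => *.
  by apply/andP; split; lra.
have Kle l : l != j -> K l <= cell_excess c (cell l).
  move=> lj; apply: le_trans (hK l lj (mu l) (mule l)) _.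
  rewrite /cell_excess [X in _ <= _ - X](_ : _ = 0) ?subr0.
    by apply: ler_prod => i _; rewrite /cell_bound ffunE /= lexx andbT;
      case: ifP => // _; rewrite mulr_ge0// invr_ge0 exprn_ge0.
  (* With this shift the coordinate exceeding [q] is a centered one; its integer part is positive
     and the subtracted indicator vanishes. *)
  pose r i := - Num.floor (t j 0 i - t l 0 i + 1 / 2).
  have jl : j != l by rewrite eq_sym.
  have [i +] := separated_coord r jl.
  rewrite /r rmorphN /= -/(centered _) -/(x l i) => hi.
  rewrite (bigD1 i)//= ffunE /= -[_ == ord0]/(mu l i == 0%N).
  have -> : (mu l i == 0%N) = false; last by rewrite mul0r.
  by apply/negbTE; rewrite -lt0n truncn_gt0 ler_pdivlMr// mul1r ltW.
rewrite -sum_cell_excess.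
apply: (@le_trans _ _ (\sum_(l in [set l | l != j]%SET) cell_excess c (cell l))).
  by rewrite big_mkcond [leRHS]big_mkcond; apply: ler_sum => l _;
    rewrite inE; case: ifP => // /Kle.
rewrite -(big_imset (cell_excess c) cell_inj) big_mkcond; apply: ler_sum => F _.
by case: ifP => // _; exact: cell_excess_ge0.
Qed.

End Separation.

(** * Weighted Toeplitz matrices *)

Section Sampling.
Local Open Scope complex_scope.
Local Open Scope sesquilinear_scope.
Variables (R : realType) (d M n : nat) (t : 'I_M -> 'rV[R]_d).
Local Notation normc := (@ComplexField.Normc.normc R).
Local Notation N := #|{: box d n}|.

Definition fourier_mx : 'M[R[i]]_(M, N) :=
  \matrix_(j, k) zpow (expi (t j)) (boxZ (enum_val k)).

Definition sampling (w : box d n -> R) : 'M[R[i]]_(M, N) :=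
  fourier_mx *m weight_mx w.

(** On the unit circle z^(-b) is the conjugate of z^b; this splits a Toeplitz entry into a row
    factor and a column factor. *)
Lemma cis2pi_expzB (x : R) (a b : nat) :
  (cis2pi x ^ (a%:Z - b%:Z))%R = (cis2pi x ^+ b)^* * cis2pi x ^+ a.
Proof.
have z0 : cis2pi x != 0.
  apply/eqP => /(congr1 normc); rewrite normc_cis2pi ComplexField.Normc.normc0.
  by move/eqP; rewrite oner_eq0.
apply: (mulIf (expf_neq0 b z0)); rewrite [X in _ * X = _]exprnP.
rewrite -expfzDr// subrK -exprnP.
rewrite mulrAC -sqr_normc_conj normcX normc_cis2pi !expr1n mul1r.
by [].
Qed.

Lemma toeplitz_expsum (f : 'I_M -> R) :
  toeplitz n (expsum f (fun j => expi (t j))) =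
  fourier_mx^t* *m diag_mx (\row_j (f j)%:C) *m fourier_mx.
Proof.
apply/matrixP => l k; rewrite mxE /expsum -mulmxA [RHS]mxE.
apply: eq_bigr => j _; rewrite mul_diag_mx !mxE mulrCA; congr (_ * _).
rewrite /zpow rmorph_prod -big_split; apply: eq_bigr => i _.
by rewrite !mxE cis2pi_expzB.
Qed.

Lemma weight_mx_herm (w : box d n -> R) : (weight_mx w)^t* = weight_mx w.
Proof. exact: diag_mx_real_herm. Qed.

Lemma weighted_toeplitz (f : 'I_M -> R) (w : box d n -> R) :
  weight_mx w *m toeplitz n (expsum f (fun j => expi (t j))) *m weight_mx w =
  wgram (sampling w) f.
Proof.
by rewrite toeplitz_expsum /wgram /sampling trmxCM weight_mx_herm !mulmxA.
Qed.

Lemma sampling_gram (w : box d n -> R) j l :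
  (sampling w *m (sampling w)^t*) j l =
  \sum_(k : box d n) (w k ^+ 2)%:C *
    \prod_i cis2pi (t j 0 i - t l 0 i) ^+ k 0 i.
Proof.
rewrite mxE [RHS](reindex _ (onW_bij _ (enum_val_bij _))) /=.
apply: eq_bigr => k _; rewrite /sampling /weight_mx mul_mx_diag !mxE.
rewrite /zpow !rmorphM /= rmorph_prod.
rewrite conj_real mulrACA mulrC -rmorphM -expr2; congr (_ * _).
rewrite -big_split; apply: eq_bigr => i _ /=.
rewrite !mxE cis2piD cis2piN exprMn; congr (_ * _).
by rewrite -!exprnP rmorphXn.
Qed.

Lemma sampling_gram_diag (w : box d n -> R) j :
  (sampling w *m (sampling w)^t*) j j = (\sum_k w k ^+ 2)%:C.
Proof.
rewrite sampling_gram rmorph_sum; apply: eq_bigr => k _.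
by rewrite big1 ?mulr1// => i _; rewrite subrr cis2pi0 expr1n.
Qed.

(** The matrix for [w'] is that for [w] times the diagonal matrix of the quotients w'_k / w_k, and
    such a product cannot have larger rank. *)
Lemma sampling_row_free (w w' : box d n -> R) : (forall k, 0 < w k) ->
  row_free (sampling w') -> row_free (sampling w).
Proof.
move=> w0; rewrite -!row_leq_rank => h; apply: leq_trans h _.
pose v k := w' k / w k.
have -> : sampling w' = sampling w *m weight_mx v.
  rewrite /sampling -mulmxA /weight_mx mulmx_diag; congr (_ *m diag_mx _).
  apply/rowP => k; rewrite !mxE -rmorphM /=; congr (_%:C).
  by rewrite mulrCA mulfV ?mulr1// gt_eqF.
exact: mxrankM_maxl.
Qed.

(** The square root appears because the Gram matrix involves squared weights. *)
Definition spline_weight (b : nat) (k : box d n) : R :=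
  Num.sqrt (\prod_i (bspline R b n)`_(k 0 i)).

Lemma spline_weight_gt0 b k : (0 < b)%N -> 0 < spline_weight b k.
Proof.
move=> b0; rewrite sqrtr_gt0; apply: prodr_gt0 => i _.
have [_] := pos_coefs_bspline R n b0; apply.
by rewrite -ltnS ltn_ord.
Qed.

(** The squared weights form a tensor product, so the sum over the box factors by distributivity. *)
Lemma spline_gram b j l : (0 < b)%N ->
  (sampling (spline_weight b) *m (sampling (spline_weight b))^t*) j l =
  \prod_i evalc (bspline R b n) (cis2pi (t j 0 i - t l 0 i)).
Proof.
move=> b0; rewrite sampling_gram.
under [RHS]eq_bigr do rewrite (evalcE _ (pos_coefs_bspline R n b0)).
rewrite bigA_distr_bigA /=.
(* Distributivity yields a sum over finite functions, whereas the box consists of row vectors. *)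
pose to_row (F : {ffun 'I_d -> 'I_n.+1}) : box d n := \row_i F i.
pose of_row (k : box d n) : {ffun 'I_d -> 'I_n.+1} := [ffun i => k 0 i].
rewrite (reindex to_row) /=; last first.
  exists of_row => [F|k] _; first by apply/ffunP => i; rewrite ffunE mxE.
  by apply/rowP => i; rewrite mxE ffunE.
apply: eq_bigr => F _; rewrite sqr_sqrtr; last first.
  apply: prodr_ge0 => i _.
  exact: pos_coefs_ge0 (pos_coefs_bspline R n b0).
rewrite rmorph_prod -big_split; apply: eq_bigr => i _ /=.
by rewrite !mxE.
Qed.


End Sampling.

(** * Spectral bounds for the spline weights *)

Section Bounds.
Local Open Scope complex_scope.
Local Open Scope sesquilinear_scope.
Variables (R : realType) (d M : nat) (t : 'I_M -> 'rV[R]_d) (q : R).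
Hypotheses (d_gt0 : (0 < d)%N) (q_gt0 : 0 < q) (t_sep : q_separated q t).
Local Notation normc := (@ComplexField.Normc.normc R).

(** A bound e for the relative deviation of the Gram spectrum from the diagonal value; the constant
    of the theorem is (1 + e) / (1 - e). *)
Definition rel_dev (n : nat) : R := (2 * d%:R / (n%:R * q)) ^+ d.+1.

Lemma rel_dev_bounds n : 2 * d%:R * q^-1 < n%:R -> 0 <= rel_dev n < 1.
Proof.
rewrite ltr_pdivrMr// => nq.
have n0 : 0 < n%:R * q by apply: le_lt_trans nq; rewrite mulr_ge0 ?ler0n.
have h0 : 0 <= 2 * d%:R / (n%:R * q).
  by rewrite divr_ge0 ?(ltW n0)// mulr_ge0 ?ler0n.
by rewrite exprn_ge0//= exprn_ilt1// ltr_pdivrMr// mul1r.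
Qed.

(** The Gram matrix has constant diagonal [s], the d-th power of the spline's value at 1. Kernel
    decay and cell counting bound its off-diagonal row sums by [s] times [rel_dev], and Gershgorin's
    estimate applies. *)
Lemma spline_sampling_bounds n : 2 * d%:R * q^-1 < n%:R ->
  exists2 s : R, 0 < s & forall c : 'cV[R[i]]_M,
    s * (1 - rel_dev n) * l2norm c ^+ 2
      <= l2norm ((sampling t (@spline_weight R d n d.+1))^t* *m c) ^+ 2
      <= s * (1 + rel_dev n) * l2norm c ^+ 2.
Proof.
move=> hn; have /andP[e0 e1] := rel_dev_bounds hn.
pose P := bspline R d.+1 n.
have P1 : 0 < P.[1].
  by rewrite bspline_at1 mulr_gt0// ?exprn_gt0 ?ltr0n.
have hn' := hn; rewrite ltr_pdivrMr// in hn'.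
have nq0 : 0 < n%:R * q by apply: le_lt_trans hn'; rewrite mulr_ge0 ?ler0n.
have n0 : (0 < n)%N by move: nq0; rewrite pmulr_lgt0// ltr0n.
have nR : 0 < (n%:R : R) by rewrite ltr0n.
have dR : 0 < (d%:R : R) by rewrite ltr0n.
set B := sampling _ _; pose s := P.[1] ^+ d.
have s0 : 0 < s by rewrite exprn_gt0.
exists s => // c.
pose c0 : R := (d.+1%:R / (2 * n%:R * q)) ^+ d.+1.
(* (d + 1) / (2 n q) is the product of 2 d / (n q) and (d + 1) / (4 d); this is the form that
   [cell_sum_le] requires. *)
have cE : c0 = rel_dev n * (d.+1%:R / (4 * d%:R)) ^+ d.+1.
  rewrite /c0 /rel_dev -exprMn; congr (_ ^+ _).
  by field; rewrite !gt_eqF.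
have c0_ge0 : 0 <= c0.
  rewrite exprn_ge0// divr_ge0 ?ler0n// mulr_ge0 ?(ltW q_gt0)// mulr_ge0 ?ler0n.
have Gd j : (B *m B^t*) j j = s%:C.
  rewrite spline_gram//; under eq_bigr do rewrite subrr cis2pi0.
  rewrite prodr_const card_ord rmorphXn /=; congr (_ ^+ _).
  by rewrite /evalc -(rmorph1 (real_complex R)) horner_map.
have Ge j : \sum_(l | l != j) normc ((B *m B^t*) j l) <= s * rel_dev n.
  pose K l := normc ((B *m B^t*) j l) / s.
  have [l _ mu hmu|L hL] := @separated_row_sum R d M t q q_gt0 t_sep c0 j K c0_ge0.
    rewrite /K ler_pdivrMr// spline_gram// normc_prod.
    rewrite [s](_ : _ = \prod_(i < d) P.[1]); last by rewrite prodr_const card_ord.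
    rewrite -big_split; apply: ler_prod => i _ /=.
    (* An integer shift leaves the kernel unchanged and brings the argument into the range |x| <=
       1/2 of the decay estimate. *)
    rewrite normc_ge0 /= -cis2pi_centered.
    case: ifPn => [_|mu0]; first by rewrite mul1r bspline_le_at1.
    have mR : 0 < ((mu i)%:R : R) by rewrite ltr0n lt0n.
    have h := @bspline_decay R d.+1 n _ ((mu i)%:R * q) (ltn0Sn d) n0
      (mulr_gt0 mR q_gt0) (hmu i) (centered_le _).
    apply: le_trans h _; rewrite ler_wpM2r ?(ltW P1)// /c0 -exprVn -exprMn.
    rewrite le_eqVlt; apply/orP; left; apply/eqP; congr (_ ^+ _).
    by field; rewrite !gt_eqF.
  rewrite -mulr_suml in hL.
  have := le_trans hL (cell_sum_le L d_gt0 _ cE).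
  rewrite ler_pdivrMr// mulrC; apply.
  by rewrite e0 ltW.
have := gram_dist_le Gd Ge c; rewrite ler_norml => /andP[h1 h2].
by apply/andP; split; move: h1 h2; set u := l2norm _ ^+ 2; lra.
Qed.

End Bounds.

Section Extrema.
Variables (R : realType) (M : nat) (M_gt0 : (0 < M)%N) (a : 'I_M -> R).

Lemma fmax_attained : exists j, fmax M_gt0 a = a j.
Proof.
apply: (big_ind (fun x => exists j, x = a j)) => [|x y [j ->] [l ->]|j _].
- by exists (Ordinal M_gt0).
- by rewrite /Num.max; case: ifP => _; [exists l | exists j].
- by exists j.
Qed.

Lemma fmin_attained : exists j, fmin M_gt0 a = a j.
Proof.
apply: (big_ind (fun x => exists j, x = a j)) => [|x y [j ->] [l ->]|j _].
- by exists (Ordinal M_gt0).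
- by rewrite /Num.min; case: ifP => _; [exists j | exists l].
- by exists j.
Qed.

Lemma fmin_fmax_bounds j : fmin M_gt0 a <= a j <= fmax M_gt0 a.
Proof. by rewrite bigmin_le le_bigmax. Qed.

End Extrema.

(** * Convergence of the upper bound *)

Section Limit.
Variables (R : realType) (d : nat) (q : R).
Hypothesis q_gt0 : 0 < q.

Lemma rel_dev_ratio (n : nat) : 2 * d%:R * q^-1 < n%:R ->
  ((n%:R * q) ^+ d.+1 + (2 * d%:R) ^+ d.+1) /
      ((n%:R * q) ^+ d.+1 - (2 * d%:R) ^+ d.+1) =
  (1 + rel_dev d q n) / (1 - rel_dev d q n).
Proof.
move=> hn; have /andP[_ e1] := rel_dev_bounds q_gt0 hn.
move: hn; rewrite ltr_pdivrMr// => hn.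
have n0 : 0 < n%:R * q by apply: le_lt_trans hn; rewrite mulr_ge0 ?ler0n.
have X0 : 0 < (n%:R * q) ^+ d.+1 by rewrite exprn_gt0.
move: e1; rewrite /rel_dev expr_div_n.
set X := (n%:R * q) ^+ _ in X0 *; set Y := (2 * _) ^+ _ => e1.
have h : Y < X by rewrite ltr_pdivrMr// mul1r in e1.
by field; rewrite !gt_eqF// subr_gt0.
Qed.

Lemma cvg_rel_dev : rel_dev d q n @[n --> \oo] --> (0 : R).
Proof.
have h : (fun n => 2 * d%:R / q * (n%:R^-1 : R)) @ \oo --> (0 : R).
  rewrite -[X in _ --> X](mulr0 (2 * d%:R / q)); apply: cvgMr.
  (* The harmonic sequence is 1 / (n + 1), hence the shift. *)
  by rewrite -cvg_shiftS; exact: cvg_harmonic.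
have -> : rel_dev d q = (fun x : R => x ^+ d.+1) \o
    (fun n => 2 * d%:R / q * (n%:R^-1 : R)).
  by apply/funext => n; rewrite /rel_dev /= invfM mulrA mulrAC.
by have := continuous_cvg _ (@exprn_continuous R d.+1 0) h; rewrite expr0n; exact.
Qed.

Lemma cvg_rel_dev_ratio (k : R) :
  (1 + rel_dev d q n) / (1 - rel_dev d q n) * k @[n --> \oo] --> k.
Proof.
rewrite -[X in _ --> X]mul1r -[X in X * k](_ : (1 + 0) / (1 - 0) = _).
  apply: cvgMl; apply: cvgM.
    exact: cvgD (cvg_cst _) cvg_rel_dev.
  apply: cvgV; first by rewrite subr0 oner_neq0.
  exact: cvgB (cvg_cst _) cvg_rel_dev.
by rewrite addr0 subr0 divr1.
Qed.

End Limit.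

Theorem theorem3p7 (R : realType) (d M : nat) (d_gt0 : (0 < d)%N)
    (M_gt0 : (0 < M)%N) (t : 'I_M -> 'rV[R]_d)
    (t01 : forall j i, 0 <= t j 0 i < 1)
    (q : R) (q_gt0 : 0 < q) (t_sep : q_separated q t)
    (fhat : 'I_M -> R) (fhat_gt0 : forall j, 0 < fhat j) :
  let T n := toeplitz n (expsum fhat (fun j => expi (t j))) in
  let kappa := fmax M_gt0 fhat / fmin M_gt0 fhat in
  let admissible n (w : box d n -> R) :=
    (forall k, 0 < w k) /\
    cond2 (weight_mx w *m T n *m weight_mx w) <=
      ((n%:R * q) ^+ d.+1 + (2 * d%:R) ^+ d.+1) /
      ((n%:R * q) ^+ d.+1 - (2 * d%:R) ^+ d.+1) * kappa in
  (forall n : nat, 2 * d%:R * q^-1 < n%:R ->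
     exists w : box d n -> R, admissible n w) /\
  (forall w : forall n : nat, box d n -> R,
     (forall n : nat, 2 * d%:R * q^-1 < n%:R -> admissible n (w n)) ->
     cond2 (weight_mx (w n) *m T n *m weight_mx (w n)) @[n --> \oo] --> kappa).
Proof.
move=> T kappa admissible.
have [jM fME] := fmax_attained M_gt0 fhat.
have [jm fmE] := fmin_attained M_gt0 fhat.
split=> [n hn|w hw].
  exists (spline_weight R d.+1); split=> [k|]; first exact: spline_weight_gt0.
  have [s s0 hs] := spline_sampling_bounds d_gt0 q_gt0 t_sep hn.
  rewrite rel_dev_ratio// /T weighted_toeplitz.
  apply: (cond2_wgram_le _ _ _ s0 (rel_dev_bounds q_gt0 hn) hs).
  - by rewrite fmE.
  - exact: fmin_fmax_bounds.
  - by rewrite fME ltW.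
(* Admissibility gives an upper bound tending to [kappa]; for the same [n], [kappa] itself is a
   lower bound, whatever the positive weights. *)
apply: (squeeze_cvgr _ (cvg_cst kappa) (cvg_rel_dev_ratio d q (k := kappa))).
near=> n.
have hn : 2 * d%:R * q^-1 < n%:R by near: n; exact: nbhs_infty_gtr.
have [w0 hc] := hw n hn; apply/andP; split; last by rewrite -rel_dev_ratio.
have [s s0 hs] := spline_sampling_bounds d_gt0 q_gt0 t_sep hn.
have /andP[_ e1] := rel_dev_bounds q_gt0 hn.
rewrite /T weighted_toeplitz /kappa fME fmE.
have a0 : 0 < s * (1 - rel_dev d q n) by rewrite mulr_gt0// subr_gt0.
apply: (@cond2_wgram_ge _ _ _ _ _ (\sum_k w n k ^+ 2)) => //.
- rewrite (bigD1 (const_mx ord0))//= ltr_pwDl ?exprn_gt0//.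
  by apply: sumr_ge0 => k _; exact: sqr_ge0.
(* Full row rank is read off from the lower bound for the spline weights and carried over to
   [w n]. *)
- apply: (sampling_row_free w0 (w' := spline_weight R d.+1)).
  apply: (@row_free_of_bounded_below _ _ _ _ (Num.sqrt (s * (1 - rel_dev d q n)))).
    by rewrite sqrtr_gt0.
  move=> c; have /andP[h _] := hs c.
  rewrite -(@ler_pXn2r _ 2)// ?nnegrE ?mulr_ge0 ?sqrtr_ge0 ?l2norm_ge0//.
  by rewrite exprMn (sqr_sqrtr (ltW a0)).
- by move=> j; exact: sampling_gram_diag.
Unshelve. all: by end_near. Qed.
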